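(* Let $n\ge 2$, $m\ge 1$, let $A\in\mathbb{R}^{n\times n}$ and let $B\in\mathbb{R}^{n\times m}$ have full column rank, with $(A,B)$ satisfying the Kalman rank condition. Let $t_{\mathrm{fn}}>0$. There is no universal continuous feedback control law for the bilinear system $\dot\Phi_t=(A+BK_t)\Phi_t$, in the following sense: there is no assignment of an integrable $K^{\Phi_{\mathrm{fn}}}_\cdot:[0,t_{\mathrm{fn}}]\to\mathbb{R}^{m\times n}$ to each $\Phi_{\mathrm{fn}}\in\mathrm{GL}^+(n,\mathbb{R})$ such that the solution $\Phi^{\Phi_{\mathrm{fn}}}_\cdot$ of $$\dot\Phi_t=(A+BK^{\Phi_{\mathrm{fn}}}_t)\Phi_t,\qquad \Phi_0=I,$$ satisfies $\Phi^{\Phi_{\mathrm{fn}}}_{t_{\mathrm{fn}}}=\Phi_{\mathrm{fn}}$ for every $\Phi_{\mathrm{fn}}\in\mathrm{GL}^+(n,\mathbb{R})$ and the map $(t,\Phi_{\mathrm{fn}})\mapsto \Phi^{\Phi_{\mathrm{fn}}}_t$ is continuous from $[0,t_{\mathrm{fn}}]\times \mathrm{GL}^+(n,\mathbb{R})$ to $\mathrm{GL}^+(n,\mathbb{R})$.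
   Context: $\mathrm{GL}^+(n,\mathbb{R})$ is the group of real $n\times n$ matrices with positive determinant. The pair $(A,B)$ satisfies the Kalman rank condition if $\mathrm{rank}[B, AB,\dots,A^{n-1}B]=n$. Solutions are absolutely continuous. *)

(* Defs.v *)
From mathcomp Require Import all_boot all_order all_algebra.
From mathcomp Require Import all_classical all_reals all_analysis.
Import Order.TTheory GRing.Theory Num.Theory.
Import numFieldNormedType.Exports.

Set Implicit Arguments.
Unset Strict Implicit.
Unset Printing Implicit Defensive.

Local Open Scope classical_set_scope.
Local Open Scope ring_scope.

Definition GLpos (R : realType) (n : nat) : set 'M[R]_n :=
  [set M | 0 < \det M].
Arguments GLpos : clear implicits.

Definition kalman_mx (R : realType) (n m : nat) (A : 'M[R]_n)
    (B : 'M[R]_(n, m)) : 'M[R]_(n, \sum_(j < n) m) :=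
  \mxrow_(j < n) (A ^+ j *m B).

Definition kalman_condition (R : realType) (n m : nat) (A : 'M[R]_n)
    (B : 'M[R]_(n, m)) : Prop :=
  \rank (kalman_mx A B) = n.

(* Integrability is with respect to the completed measure, i.e. for Lebesgue
   (and not only Borel) measurable entries. *)
Definition mx_integrable (R : realType) (p q : nat) (D : set R)
    (K : R -> 'M[R]_(p, q)) : Prop :=
  forall i j, (@completed_lebesgue_measure R).-integrable D
    (fun t => (K t i j)%:E).

Definition absolutely_continuous (R : realType) (V : normedModType R)
    (a b : R) (f : R -> V) : Prop :=
  forall e : R, 0 < e -> exists2 d : R, 0 < d &
    forall (k : nat) (u v : 'I_k -> R),
      (forall i, a <= u i /\ u i <= v i /\ v i <= b) ->
      trivIset [set: 'I_k] (fun i => `]u i, v i[%classic) ->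
      \sum_(i < k) (v i - u i) < d ->
      \sum_(i < k) `|f (v i) - f (u i)| < e.

(* Caratheodory solution on [0, T].  Phi is a function on all of R; its values
   outside [0, T] are irrelevant, the endpoints being negligible for the
   almost-everywhere (two-sided) derivative. *)
Definition is_solution (R : realType) (n m : nat) (A : 'M[R]_n)
    (B : 'M[R]_(n, m)) (T : R) (K : R -> 'M[R]_(m, n))
    (Phi : R -> 'M[R]_n) : Prop :=
  [/\ absolutely_continuous 0 T Phi,
      {ae (@completed_lebesgue_measure R), forall t, t \in `[0, T] ->
         is_derive t 1 Phi ((A + B *m K t) *m Phi t)}
    & Phi 0 = 1%:M].

(* Main.v *)
Require Import Defs.
From mathcomp Require Import all_boot all_order all_algebra.
From mathcomp Require Import all_classical all_reals all_analysis.
From mathcomp Require Import ring lra.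
Import Order.TTheory GRing.Theory Num.Theory.
Import numFieldNormedType.Exports.

Set Implicit Arguments.
Unset Strict Implicit.
Unset Printing Implicit Defensive.

Local Open Scope classical_set_scope.
Local Open Scope ring_scope.

(** A universal continuous feedback would give a continuous family
    (t, F) |-> Phi F t joining the constant map 1 (at t = 0) to the identity
    (at t = tfn) inside GL+(n), so the loop of full rotations of a coordinate
    plane would be freely null-homotopic in GL+(n).  This is impossible because
    that loop does not lift to the spin group.

    The lift is discretised so that no covering space is needed.  Gram-Schmidt
    turns a matrix into an orthonormal frame, hence into a system U of
    anticommuting involutions of a Clifford algebra.  Averaging 1 by the maps
    T |-> (T + U i T V i) / 2 yields a matrix depending polynomially on the
    systems U and V, intertwining them, and invertible when V is close to U.
    Multiplying the intertwiners along a fine subdivision of a loop gives a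
    matrix that commutes with an irreducible system, i.e. a scalar.  Along a
    homotopy of loops this scalar is continuous and never zero, yet it is 1 for
    the constant loop and - cos (pi / N) ^+ N for the rotation loop. *)

(** * Clifford systems and their intertwiners *)

(* D holds extra matrices, untouched when the frame varies, whose only role is
   to make the system irreducible (see commutant_scalar). *)
Definition clifford_frame (R : numFieldType) d (D : 'M[R]_d -> Prop)
    (I : eqType) (U : I -> 'M[R]_d) :=
  [/\ forall i, U i *m U i = 1%:M,
      forall i j, i != j -> U i *m U j = - (U j *m U i)
    & forall i X, D X -> U i *m X = - (X *m U i)].

Definition commutant_scalar (R : numFieldType) d (D : 'M[R]_d -> Prop)
    (I : Type) (U : I -> 'M[R]_d) :=
  forall M, (forall i, U i *m M = M *m U i) ->
    (forall X, D X -> X *m M = M *m X) -> exists c, M = c%:M.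

(** Induction on n, doubling the dimension: an old generator X becomes diag (X, - X) and the block
    swap [g0] is the new generator. As [e0] squares to -1, it goes into [D] instead. A matrix
    commuting with both [g0] and [e0] has the form diag (a, a), and a then commutes with the smaller
    system. *)
Lemma exists_clifford_frame (R : numFieldType) n :
  exists d (D : 'M[R]_d.+1 -> Prop) (g : 'I_n -> 'M[R]_d.+1),
    clifford_frame D g /\ commutant_scalar D g.
Proof.
elim: n => [|n [d [D [g [[gg gC gD] cg]]]]].
  exists 0%N, (fun=> False), (fun=> 0); split; first by split => // -[].
  by move=> M _ _; exists (M 0 0); exact: mx11_scalar.
pose inj (X : 'M[R]_d.+1) : 'M[R]_(d.+1 + d.+1) := block_mx X 0 0 (- X).
pose g0 : 'M[R]_(d.+1 + d.+1) := block_mx 0 1%:M 1%:M 0.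
pose e0 : 'M[R]_(d.+1 + d.+1) := block_mx 0 1%:M (- 1%:M) 0.
have injg0 X : inj X *m g0 = - (g0 *m inj X).
  by rewrite !mulmx_block opp_block_mx !(mul0mx, mulmx0, add0r, addr0, mulmx1,
    mul1mx, oppr0, opprK).
have inje0 X : inj X *m e0 = - (e0 *m inj X).
  by rewrite !mulmx_block opp_block_mx !(mul0mx, mulmx0, add0r, addr0, mulmx1,
    mul1mx, oppr0, opprK, mulmxN, mulNmx).
have injM X Y : inj X *m inj Y = block_mx (X *m Y) 0 0 (X *m Y).
  by rewrite !mulmx_block !(mul0mx, mulmx0, add0r, addr0, mulmxN, mulNmx, opprK).
have injC X Y : X *m Y = - (Y *m X) -> inj X *m inj Y = - (inj Y *m inj X).
  by move=> XY; rewrite !injM opp_block_mx -XY !oppr0.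
have one2 : block_mx 1%:M 0 0 1%:M = 1%:M :> 'M[R]_(d.+1 + d.+1).
  by rewrite -scalar_mx_block.
have g0g0 : g0 *m g0 = 1%:M.
  by rewrite mulmx_block !(mul0mx, mulmx0, add0r, addr0, mulmx1) one2.
have g0e0 : g0 *m e0 = - (e0 *m g0).
  by rewrite !mulmx_block opp_block_mx !(mul0mx, mulmx0, add0r, addr0, mulmx1,
    mul1mx, oppr0, opprK, mulmxN, mulNmx).
(* The successor of this number is convertible to [d.+1 + d.+1], which allows block matrices. Index
   [ord0] carries the new generator. *)
exists (d + d.+1)%N,
  (fun X => X = e0 \/ exists2 Y, D Y & X = inj Y),
  (fun i => if unlift ord0 i is Some j then inj (g j) else g0).
split; first split.
- move=> i; case: unliftP => [j|] _; last exact: g0g0.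
  by have := injM (g j) (g j); rewrite gg one2.
- move=> i j; case: unliftP => [i'|] ->; case: unliftP => [j'|] -> //.
  + by rewrite (inj_eq lift_inj) => /gC /injC.
  + by rewrite (injg0 (g j')) opprK.
- move=> i X; case: unliftP => [j|] _ [->|[Y DY ->]].
  + exact: inje0.
  + by apply: injC; apply: gD.
  + exact: g0e0.
  + by rewrite (injg0 Y) opprK.
move=> M Mg MD.
have [a [b [c [e ME]]]] :
    exists a b c e, M = block_mx a b c e :> 'M[R]_(d.+1 + d.+1).
  by exists (ulsubmx (M : 'M[R]_(d.+1 + d.+1))), (ursubmx (M : 'M[R]_(d.+1 + d.+1))),
    (dlsubmx (M : 'M[R]_(d.+1 + d.+1))), (drsubmx (M : 'M[R]_(d.+1 + d.+1)));
  rewrite submxK.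
have /= : g0 *m block_mx a b c e = block_mx a b c e *m g0.
  by have := Mg ord0; rewrite unlift_none ME.
rewrite !mulmx_block.
rewrite !(mul0mx, mulmx0, add0r, addr0, mulmx1, mul1mx).
move=> /eq_block_mx[cb ea _ _].
have : e0 *m block_mx a b c e = block_mx a b c e *m e0.
  by have := MD e0 (or_introl erefl); rewrite ME.
rewrite !mulmx_block.
rewrite !(mul0mx, mulmx0, add0r, addr0, mulmx1, mul1mx, mulmxN, mulNmx).
move=> /eq_block_mx[cNb _ _ _].
have b0 : b = 0.
  have /eqP := cb; rewrite cNb -subr_eq0 -opprD oppr_eq0 -mulr2n -scaler_nat.
  by rewrite scaler_eq0 pnatr_eq0 /= => /eqP.
have aC X : inj X *m (M : 'M[R]_(d.+1 + d.+1)) = (M : 'M[R]_(d.+1 + d.+1)) *m inj X ->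
    X *m a = a *m X.
  rewrite ME /inj !mulmx_block !(mul0mx, mulmx0, add0r, addr0).
  by move=> /eq_block_mx[].
have [k ak] : exists k, a = k%:M.
  apply: cg => [i|X DX]; last by apply/aC/MD; right; exists X.
  by have := Mg (lift ord0 i); rewrite liftK => /aC.
exists k; rewrite ME ea ak cb b0.
exact/esym/(scalar_mx_block d.+1 d.+1 k).
Qed.

Fixpoint intertwiner (R : numFieldType) d (I : Type) (U V : I -> 'M[R]_d)
    (s : seq I) : 'M[R]_d :=
  if s is i :: s' then
    2^-1 *: (intertwiner U V s' + U i *m intertwiner U V s' *m V i)
  else 1%:M.

(** An average of T and U i T V i is fixed by the involution T |-> U i T V i, which is the relation
    at the head index. At any other index the signs from the two anticommutations cancel, so
    relations obtained earlier survive later averages. *)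
Lemma intertwinerP (R : numFieldType) d (D : 'M[R]_d -> Prop) (I : eqType)
    (U V : I -> 'M[R]_d) (s : seq I) (i : I) :
  clifford_frame D U -> clifford_frame D V -> i \in s ->
  U i *m intertwiner U V s = intertwiner U V s *m V i.
Proof.
move=> [UU UC _] [VV VC _]; elim: s => //= j s IH; rewrite inE.
rewrite -scalemxAr -scalemxAl mulmxDr mulmxDl !mulmxA.
have [<- _|ij /= /IH {}IH] := eqVneq i j.
  by rewrite UU mul1mx -[_ *m V i *m V i]mulmxA VV mulmx1 addrC.
rewrite IH UC // !mulNmx -[U j *m U i *m _]mulmxA IH.
by rewrite -!mulmxA (VC i j ij) !mulmxN opprK.
Qed.

Lemma intertwiner_comm (R : numFieldType) d (D : 'M[R]_d -> Prop) (I : eqType)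
    (U V : I -> 'M[R]_d) (s : seq I) (X : 'M[R]_d) :
  clifford_frame D U -> clifford_frame D V -> D X ->
  X *m intertwiner U V s = intertwiner U V s *m X.
Proof.
move=> [_ _ UD] [_ _ VD] DX; elim: s => [|i s IH] /=.
  by rewrite mulmx1 mul1mx.
rewrite -scalemxAr -scalemxAl mulmxDr mulmxDl !mulmxA IH.
have -> : X *m U i = - (U i *m X) by rewrite UD // opprK.
rewrite !mulNmx -[U i *m X *m _]mulmxA IH.
by rewrite -!mulmxA (VD _ _ DX) !mulmxN.
Qed.

Lemma half_double (R : numFieldType) (V : lmodType R) (v : V) :
  2^-1 *: (v + v) = v.
Proof.
by rewrite -mulr2n -scalerMnr scalerMnl -mulr_natr mulVf ?scale1r ?pnatr_eq0.
Qed.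

Lemma intertwiner_id (R : numFieldType) d (I : eqType) (U V : I -> 'M[R]_d)
    (s : seq I) :
  {in s, forall i, U i *m V i = 1%:M} -> intertwiner U V s = 1%:M.
Proof.
elim: s => //= i s IH UV; rewrite IH => [|j js]; last first.
  by apply: UV; rewrite inE js orbT.
by rewrite mulmx1 UV ?mem_head // half_double.
Qed.

(** Discrete, unnormalised counterpart of lifting a path of frames to the spin group. *)
Fixpoint transport (R : numFieldType) d (I : Type) (F : nat -> I -> 'M[R]_d)
    (s : seq I) (N : nat) : 'M[R]_d :=
  if N is k.+1 then transport F s k *m intertwiner (F k) (F k.+1) s else 1%:M.

Lemma transportP (R : numFieldType) d (D : 'M[R]_d -> Prop) (I : eqType)
    (F : nat -> I -> 'M[R]_d) (s : seq I) (N : nat) (i : I) :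
  (forall k, clifford_frame D (F k)) -> i \in s ->
  F 0 i *m transport F s N = transport F s N *m F N i.
Proof.
move=> DF si; elim: N => [|N IH] /=.
  by rewrite mulmx1 mul1mx.
rewrite mulmxA IH -!mulmxA.
by rewrite (intertwinerP (DF N) (DF N.+1) si).
Qed.

Lemma transport_comm (R : numFieldType) d (D : 'M[R]_d -> Prop) (I : eqType)
    (F : nat -> I -> 'M[R]_d) (s : seq I) (N : nat) (X : 'M[R]_d) :
  (forall k, clifford_frame D (F k)) -> D X ->
  X *m transport F s N = transport F s N *m X.
Proof.
move=> DF DX; elim: N => [|N IH] /=.
  by rewrite mulmx1 mul1mx.
rewrite mulmxA IH -!mulmxA.
by rewrite (intertwiner_comm s (DF N) (DF N.+1) DX).
Qed.

Lemma transport_const (R : numFieldType) d (D : 'M[R]_d -> Prop) (I : eqType)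
    (F : nat -> I -> 'M[R]_d) (s : seq I) (N : nat) :
  (forall k, clifford_frame D (F k)) -> (forall k, F k =1 F k.+1) ->
  transport F s N = 1%:M.
Proof.
move=> DF FE; elim: N => [|N IH] //=.
rewrite IH mul1mx; apply: intertwiner_id => i _; rewrite -FE.
by case: (DF N).
Qed.

Lemma det_transport_neq0 (R : numFieldType) d (I : eqType)
    (F : nat -> I -> 'M[R]_d) (s : seq I) (N : nat) :
  (forall k, (k < N)%N -> \det (intertwiner (F k) (F k.+1) s) != 0) ->
  \det (transport F s N) != 0.
Proof.
elim: N => [|N IH] detF /=; first by rewrite det1 oner_eq0.
rewrite det_mulmx mulf_neq0 ?detF ?IH // => k kN.
by apply: detF; rewrite ltnW.
Qed.

(** The Clifford element of the k-th column of q; an orthogonal q thus turns g into the system of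
    another orthonormal frame. *)
Definition frame_comb (R : numFieldType) d n (g : 'I_n -> 'M[R]_d) (q : 'M[R]_n)
    (k : 'I_n) : 'M[R]_d := \sum_i q i k *: g i.

(** This is the polarised Clifford relation v w + w v = 2 <v, w>: after exchanging the sums, the
    terms with distinct generators cancel and the squares leave the inner product of two columns. *)
Lemma frame_comb_anticomm (R : numFieldType) d (D : 'M[R]_d -> Prop) n
    (g : 'I_n -> 'M[R]_d) (q : 'M[R]_n) (k l : 'I_n) :
  clifford_frame D g ->
  frame_comb g q k *m frame_comb g q l + frame_comb g q l *m frame_comb g q k =
    (2 * (q^T *m q) k l)%:M.
Proof.
move=> [gg gC _]; rewrite /frame_comb !mulmx_suml.
under eq_bigr do rewrite mulmx_sumr.
under [X in _ + X]eq_bigr do rewrite mulmx_sumr.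
rewrite [X in _ + X]exchange_big -big_split /= mxE mulr_sumr.
rewrite (raddf_sum (@scalar_mx R d)); apply: eq_bigr => i _ /=.
rewrite -big_split /= (bigD1 i) //= big1 => [|j ji]; last first.
  rewrite -!scalemxAl -!scalemxAr !scalerA mulrC -scalerDr.
  by rewrite gC 1?eq_sym // addNr scaler0.
rewrite -!scalemxAl -!scalemxAr !scalerA gg addr0 mxE mulrC -mulr2n -scaler_nat.
by rewrite scalerA scalemx1.
Qed.

Lemma clifford_frame_comb (R : numFieldType) d (D : 'M[R]_d -> Prop) n
    (g : 'I_n -> 'M[R]_d) (q : 'M[R]_n) :
  clifford_frame D g -> q^T *m q = 1%:M -> clifford_frame D (frame_comb g q).
Proof.
move=> Dg qq; split=> [i|i j ij|i X DX].
- rewrite -[LHS]half_double (frame_comb_anticomm _ _ _ Dg) qq mxE eqxx mulr1.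
  by rewrite scale_scalar_mx mulVf ?pnatr_eq0.
- apply/eqP; rewrite -addr_eq0 (frame_comb_anticomm _ _ _ Dg) qq mxE (negbTE ij).
  by rewrite mulr0 raddf0.
case: Dg => _ _ gD; rewrite mulmx_suml mulmx_sumr -sumrN; apply: eq_bigr => k _.
by rewrite -scalemxAl -scalemxAr gD // scalerN.
Qed.

(** Carries irreducibility from g to every orthonormal frame: q is invertible with inverse its
    transpose, so each g i is a combination of the new elements. *)
Lemma frame_comb_comm (R : numFieldType) d n (g : 'I_n -> 'M[R]_d) (q : 'M[R]_n)
    (M : 'M[R]_d) :
  q^T *m q = 1%:M ->
  (forall k, frame_comb g q k *m M = M *m frame_comb g q k) ->
  forall i, g i *m M = M *m g i.
Proof.
move=> /mulmx1C qq qM i.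
have -> : g i = \sum_k q i k *: frame_comb g q k.
  under eq_bigr do rewrite scaler_sumr.
  rewrite exchange_big /= -[LHS]scale1r -(big_pred1_eq +%R i (fun j => 1 *: g j)).
  rewrite big_mkcond; apply: eq_bigr => j _.
  under eq_bigr do rewrite scalerA.
  rewrite -scaler_suml.
  have -> : \sum_k q i k * q j k = (q *m q^T) i j.
    by rewrite mxE; under [RHS]eq_bigr do rewrite mxE.
  by rewrite qq mxE eq_sym; case: eqVneq => _; rewrite ?scale1r ?scale0r.
rewrite mulmx_suml mulmx_sumr; apply: eq_bigr => k _.
by rewrite -scalemxAl -scalemxAr qM.
Qed.

(** * The rotation loop *)

Definition rot2 (R : realType) (a : R) : 'M[R]_2 :=
  \matrix_(i, j) if i == j then cos a else if i == ord0 then - sin a else sin a.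

Definition rot (R : realType) n (a : R) : 'M[R]_(2 + n) :=
  block_mx (rot2 a) 0 0 1%:M.

Lemma rot_orthogonal (R : realType) n (a : R) : (rot n a)^T *m rot n a = 1%:M.
Proof.
rewrite tr_block_mx mulmx_block !(trmx0, mulmx0, mul0mx, addr0, add0r, trmx1).
rewrite mulmx1 (scalar_mx_block 2 n); congr block_mx; apply/matrixP => i j.
rewrite !mxE !big_ord_recl big_ord0 !mxE -(cos2Dsin2 a).
case: i => -[|[|//]] ?; case: j => -[|[|//]] ? /=; rewrite ?mulr1n ?mulr0n.
- by rewrite addr0 -!expr2.
- by rewrite mulrN addr0 [X in _ + X]mulrC addNr.
- by rewrite mulNr addr0 mulrC addNr.
- by rewrite mulrNN addr0 -!expr2 addrC.
Qed.

Lemma det_rot (R : realType) n (a : R) : \det (rot n a) = 1.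
Proof.
rewrite det_ublock det1 mulr1 (expand_det_row _ ord0) !big_ord_recl big_ord0.
rewrite /cofactor !det_mx11 !mxE /= -[RHS](cos2Dsin2 a) expr0 expr1; ring.
Qed.

(** For anticommuting involutions (a b)^2 = -1, so this is the spin element exp (t a b). *)
Definition rotor (R : realType) d (a b : 'M[R]_d) (t : R) : 'M[R]_d :=
  cos t *: 1%:M + sin t *: (a *m b).

Section RotationPlane.
Variables (R : realType) (d : nat) (a b : 'M[R]_d).
Hypotheses (aa : a *m a = 1%:M) (bb : b *m b = 1%:M).
Hypothesis ab : b *m a = - (a *m b).

Lemma plane_mul (x y x' y' : R) :
  (x *: a + y *: b) *m (x' *: a + y' *: b) =
  (x * x' + y * y') *: 1%:M + (x * y' - y * x') *: (a *m b).
Proof.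
rewrite !mulmxDl !mulmxDr -!scalemxAl -!scalemxAr aa bb ab !scalerA !scalerN.
by move: (a *m b) => J; apply/matrixP => i j; rewrite !mxE; ring.
Qed.

Lemma plane_mul_rotor (x y C S : R) :
  (x *: a + y *: b) *m (C *: 1%:M + S *: (a *m b)) =
  (x * C - y * S) *: a + (x * S + y * C) *: b.
Proof.
have baab : b *m (a *m b) = - a.
  by rewrite mulmxA ab mulNmx -mulmxA bb mulmx1.
have aab : a *m (a *m b) = b by rewrite mulmxA aa mul1mx.
rewrite !mulmxDl !mulmxDr -!scalemxAl -!scalemxAr !mulmx1 aab baab !scalerA.
by apply/matrixP => i j; rewrite !mxE; ring.
Qed.

Lemma rotorD (s t : R) : rotor a b s *m rotor a b t = rotor a b (s + t).
Proof.
have JJ : (a *m b) *m (a *m b) = - 1%:M.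
  by rewrite mulmxA -(mulmxA a b a) ab mulmxN mulNmx -!mulmxA bb mulmx1 aa.
rewrite /rotor cosD sinD !mulmxDl !mulmxDr -!scalemxAl -!scalemxAr.
rewrite !mulmx1 !mul1mx JJ.
by move: (a *m b) => J; apply/matrixP => i j; rewrite !mxE; ring.
Qed.

(* The spin lift of the rotation from angle s to angle t is the half-angle
   rotor, up to the positive factor cos ((t - s) / 2). *)
Lemma intertwiner_plane (s t : R) :
  let p x := cos x *: a + sin x *: b in
  let q x := - sin x *: a + cos x *: b in
  2^-1 *: (2^-1 *: (1%:M + q s *m q t) +
    p s *m (2^-1 *: (1%:M + q s *m q t)) *m p t) =
  cos ((t - s) / 2) *: rotor a b ((t - s) / 2).
Proof.
move=> p q; set r := (t - s) / 2.
have pp x y : p x *m p y = rotor a b (y - x).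
  by rewrite plane_mul /rotor cosB sinB; congr (_ *: _ + _ *: _); ring.
have qq x y : q x *m q y = rotor a b (y - x).
  by rewrite plane_mul /rotor cosB sinB; congr (_ *: _ + _ *: _); ring.
have pr x y : p x *m rotor a b y = p (x + y).
  by rewrite /p /rotor plane_mul_rotor cosD sinD; congr (_ *: _ + _ *: _); ring.
(* Both terms of the outer average equal (1 + rotor (t - s)) / 2. The double-angle formulas then
   extract the factor cos r and leave the rotor of angle r. *)
clearbody p q; rewrite qq -scalemxAr mulmxDr mulmx1 pr -scalemxAl mulmxDl !pp.
have -> : t - (s + (t - s)) = 0 by ring.
rewrite [X in _ + _ *: X]addrC -scalerDr.
have -> : rotor a b 0 = 1%:M by rewrite /rotor cos0 sin0 scale0r addr0 scale1r.
rewrite half_double.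
have -> : t - s = r *+ 2 by rewrite /r; field.
rewrite /rotor cos_mulr2n sin_mulr2n.
by move: (a *m b) => J; apply/matrixP => i j; rewrite !mxE; field.
Qed.

End RotationPlane.

Lemma frame_comb_rot (R : realType) d n (g : 'I_(2 + n) -> 'M[R]_d) (t : R) :
  let a := g (lshift n ord0) in let b := g (lshift n ord_max) in
  [/\ frame_comb g (rot n t) (lshift n ord0) = cos t *: a + sin t *: b,
      frame_comb g (rot n t) (lshift n ord_max) = - sin t *: a + cos t *: b
    & forall i, frame_comb g (rot n t) (rshift 2 i) = g (rshift 2 i)].
Proof.
have E1 : lift ord0 ord0 = ord_max :> 'I_2 by apply: val_inj.
rewrite /frame_comb; split=> [||i]; rewrite big_split_ord /=.
- rewrite [X in _ + X]big1 => [|i _]; last by rewrite block_mxEdl mxE scale0r.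
  by rewrite addr0 !big_ord_recl big_ord0 addr0 !block_mxEul !mxE /= E1.
- rewrite [X in _ + X]big1 => [|i _]; last by rewrite block_mxEdl mxE scale0r.
  by rewrite addr0 !big_ord_recl big_ord0 addr0 !block_mxEul !mxE /= E1.
rewrite [X in X + _]big1 => [|j _]; last by rewrite block_mxEur mxE scale0r.
rewrite add0r (bigD1 i) //= block_mxEdr mxE eqxx scale1r big1 ?addr0 // => j ji.
by rewrite block_mxEdr mxE (negbTE ji) scale0r.
Qed.

Lemma intertwiner_rot (R : realType) d (D : 'M[R]_d -> Prop) n
    (g : 'I_(2 + n) -> 'M[R]_d) (s t : R) :
  clifford_frame D g ->
  intertwiner (frame_comb g (rot n s)) (frame_comb g (rot n t))
      (enum 'I_(2 + n)) =
  cos ((t - s) / 2) *: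
    rotor (g (lshift n ord0)) (g (lshift n ord_max)) ((t - s) / 2).
Proof.
move=> [gg gC _]; have [s0 s1 sr] := frame_comb_rot g s.
have [t0 t1 tr] := frame_comb_rot g t.
(* The tail of the list is averaged first: the axes orthogonal to the plane are fixed by both
   rotations and contribute 1, leaving the two plane axes outermost. *)
have -> : enum 'I_(2 + n) =
    [:: lshift n ord0, lshift n ord_max & map (@rshift 2 n) (enum 'I_n)].
  rewrite !enum_ordSl /= -map_comp; congr [:: _, _ & _]; try exact: val_inj.
  by apply: eq_map => i; exact: val_inj.
rewrite /= intertwiner_id => [|_ /mapP[i _ ->]]; last by rewrite sr tr gg.
rewrite mulmx1 s0 s1 t0 t1; apply: intertwiner_plane => //.
exact: gC.
Qed.

(** Each step of angle h contributes a rotor of angle h / 2, and rotor angles add. A full turn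
    therefore ends at rotor angle pi, that is at -1. *)
Lemma transport_rot (R : realType) d (D : 'M[R]_d -> Prop) n
    (g : 'I_(2 + n) -> 'M[R]_d) (h : R) N :
  clifford_frame D g ->
  transport (fun k => frame_comb g (rot n (h * k%:R))) (enum 'I_(2 + n)) N =
  cos (h / 2) ^+ N *:
    rotor (g (lshift n ord0)) (g (lshift n ord_max)) (h / 2 * N%:R).
Proof.
move=> Dg; elim: N => [|N IH].
  by rewrite /= expr0 scale1r mulr0 /rotor cos0 sin0 scale0r addr0 scale1r.
case: (Dg) => gg gC _.
rewrite [LHS]/= IH (intertwiner_rot _ _ Dg) -scalemxAl -scalemxAr scalerA.
rewrite rotorD ?gg //; last exact: gC.
have -> : h * N.+1%:R - h * N%:R = h by rewrite -natr1; ring.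
by rewrite -exprSr -[N.+1%:R]natr1 mulrDr mulr1.
Qed.

(** * Continuity of matrix-valued maps *)

Definition entrywise_continuous (R : realType) (X : topologicalType) p q
    (f : X -> 'M[R]_(p, q)) := forall i j, continuous (fun x => f x i j).

Section EntrywiseContinuous.
Variables (R : realType) (X : topologicalType).

Lemma continuous_sum (I : Type) (r : seq I) (f : I -> X -> R) :
  (forall i, continuous (f i)) -> continuous (fun x => \sum_(i <- r) f i x).
Proof. by move=> cf; apply: continuous_big => //; exact: add_continuous. Qed.

Lemma continuous_prod (I : Type) (r : seq I) (f : I -> X -> R) :
  (forall i, continuous (f i)) -> continuous (fun x => \prod_(i <- r) f i x).
Proof. by move=> cf; apply: continuous_big => //; exact: mul_continuous. Qed.

Lemma entrywise_continuous_cst p q (A : 'M[R]_(p, q)) :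
  entrywise_continuous (fun _ : X => A).
Proof. by move=> i j x; exact: cvg_cst. Qed.

Lemma entrywise_continuousD p q (f g : X -> 'M[R]_(p, q)) :
  entrywise_continuous f -> entrywise_continuous g ->
  entrywise_continuous (fun x => f x + g x).
Proof.
move=> cf cg i j; under eq_fun do rewrite mxE.
by move=> x; apply: cvgD; [exact: cf | exact: cg].
Qed.

Lemma entrywise_continuousB p q (f g : X -> 'M[R]_(p, q)) :
  entrywise_continuous f -> entrywise_continuous g ->
  entrywise_continuous (fun x => f x - g x).
Proof.
move=> cf cg i j; under eq_fun do rewrite !mxE.
by move=> x; apply: cvgB; [exact: cf | exact: cg].
Qed.

Lemma entrywise_continuousZ p q (c : X -> R) (f : X -> 'M[R]_(p, q)) :
  continuous c -> entrywise_continuous f ->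
  entrywise_continuous (fun x => c x *: f x).
Proof.
move=> cc cf i j; under eq_fun do rewrite mxE.
by move=> x; apply: cvgM; [exact: cc | exact: cf].
Qed.

Lemma entrywise_continuousM p q r (f : X -> 'M[R]_(p, q)) (g : X -> 'M[R]_(q, r)) :
  entrywise_continuous f -> entrywise_continuous g ->
  entrywise_continuous (fun x => f x *m g x).
Proof.
move=> cf cg i j; under eq_fun do rewrite mxE.
by apply: continuous_sum => k x; apply: cvgM; [exact: cf | exact: cg].
Qed.

Lemma entrywise_continuous_tr p q (f : X -> 'M[R]_(p, q)) :
  entrywise_continuous f -> entrywise_continuous (fun x => (f x)^T).
Proof. by move=> cf i j; under eq_fun do rewrite mxE; exact: cf. Qed.

Lemma entrywise_continuous_sum p q (I : Type) (r : seq I)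
    (f : I -> X -> 'M[R]_(p, q)) :
  (forall i, entrywise_continuous (f i)) ->
  entrywise_continuous (fun x => \sum_(i <- r) f i x).
Proof.
move=> cf i j; under eq_fun do rewrite summxE.
by apply: continuous_sum => k; exact: cf.
Qed.

Lemma continuous_det p (f : X -> 'M[R]_p) :
  entrywise_continuous f -> continuous (fun x => \det (f x)).
Proof.
move=> cf; rewrite /determinant; apply: continuous_sum => s x.
apply: cvgM; first exact: cvg_cst.
by apply: continuous_prod => i; exact: cf.
Qed.

End EntrywiseContinuous.

Lemma entrywise_continuous_continuous (R : realType) (X : topologicalType) p q
    (f : X -> 'M[R]_(p, q)) : entrywise_continuous f -> continuous f.
Proof.
move=> cf; have -> : f = (fun x => \sum_i \sum_j f x i j *: delta_mx i j).
  by apply/funext => x; exact: matrix_sum_delta.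
apply: continuous_big => [|i _]; first exact: add_continuous.
apply: continuous_big => [|j _ x]; first exact: add_continuous.
by apply: cvgZr_tmp; exact: cf.
Qed.

Lemma entrywise_continuous_comp (R : realType) (X Y : topologicalType) p q
    (f : Y -> 'M[R]_(p, q)) (h : X -> Y) :
  continuous h -> entrywise_continuous f -> entrywise_continuous (f \o h).
Proof.
move=> ch cf i j x; apply: (@continuous_comp _ _ _ h (fun y => f y i j)).
  exact: ch.
exact: cf.
Qed.

Lemma continuous_comp_within (X Y Z : topologicalType) (A : set Y) (f : Y -> Z)
    (c : X -> Y) :
  {within A, continuous f} -> continuous c -> (forall x, A (c x)) ->
  continuous (f \o c).
Proof.
move=> /subspace_continuousP cf cc Ac x; apply: cvg_comp; last exact: cf (Ac x).
move=> V /cc cV; apply: (@filterS _ (nbhs x) _ _ (c @^-1` V) _ cV) => y.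
by move=> /(_ (Ac y)).
Qed.

Lemma entrywise_continuous_rot (R : realType) n :
  entrywise_continuous (@rot R n).
Proof.
move=> i j; rewrite /rot.
have c2 : entrywise_continuous (@rot2 R).
  move=> k l; under eq_fun do rewrite mxE.
  case: eqP => _; first exact: continuous_cos.
  case: eqP => _ x; last exact: continuous_sin.
  by apply: cvgN; exact: continuous_sin.
case: (split_ordP i) => k ->; case: (split_ordP j) => l ->.
- by under eq_fun do rewrite block_mxEul; exact: c2.
- by under eq_fun do rewrite block_mxEur; move=> x; exact: cvg_cst.
- by under eq_fun do rewrite block_mxEdl; move=> x; exact: cvg_cst.
- by under eq_fun do rewrite block_mxEdr; move=> x; exact: cvg_cst.
Qed.

(** * Gram-Schmidt orthonormalisation *)

Section GramSchmidt.
Variables (R : realType) (n : nat).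
Implicit Types (v w : 'cV[R]_n) (g : 'M[R]_n) (a : nat -> 'cV[R]_n).

Definition sqnorm w : R := (w^T *m w) 0 0.

Definition normalize w := (Num.sqrt (sqnorm w))^-1 *: w.

(* The orthogonal projector onto the complement of a 0, ..., a k.-1. *)
Fixpoint gs_proj a k : 'M[R]_n :=
  if k is j.+1 then
    gs_proj a j - normalize (gs_proj a j *m a j) *m
                  (normalize (gs_proj a j *m a j))^T
  else 1%:M.

Definition gs_vec a k := normalize (gs_proj a k *m a k).

Lemma sqnorm_gt0 w : w != 0 -> 0 < sqnorm w.
Proof.
have sq_ge0 (i : 'I_n) : true -> 0 <= w^T 0 i * w i 0.
  by move=> _; rewrite mxE -expr2 sqr_ge0.
move=> w0; rewrite /sqnorm mxE lt_def sumr_ge0 // andbT.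
apply: contra_neq w0 => /(psumr_eq0P sq_ge0) s0; apply/matrixP => i j.
by have /eqP := s0 i isT; rewrite ord1 !mxE mulf_eq0 orbb => /eqP.
Qed.

Lemma normalizeP w : w != 0 -> (normalize w)^T *m normalize w = 1%:M.
Proof.
move=> /sqnorm_gt0 w0; rewrite /normalize -scalemxAr [_^T]linearZ /= -scalemxAl scalerA.
rewrite [X in _ *: X]mx11_scalar -/(sqnorm w) scale_scalar_mx -invfM -expr2.
by rewrite sqr_sqrtr ?ltW // mulVf // gt_eqF.
Qed.

(** The unit vector u = [gs_vec a k] lies in the range of the projector P, so P - u u^T is again a
    symmetric idempotent. It kills u as well as everything that P kills. *)
Lemma gs_projP a k : (forall j, (j < k)%N -> gs_proj a j *m a j != 0) ->
  [/\ (gs_proj a k)^T = gs_proj a k, gs_proj a k *m gs_proj a k = gs_proj a k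
    & forall j, (j < k)%N -> gs_proj a k *m gs_vec a j = 0].
Proof.
elim: k => [|k IH] a0; first by rewrite trmx1 mulmx1.
have [|PT PP P0] := IH; first by move=> j jk; apply: a0; rewrite ltnW.
rewrite /= -/(gs_vec a k); set u := gs_vec a k; set P := gs_proj a k in PT PP P0 *.
have uu : u^T *m u = 1%:M by apply: normalizeP; exact: a0.
have Pu : P *m u = u.
  by rewrite /u /gs_vec /normalize -scalemxAr mulmxA -/P PP.
have uP : u^T *m P = u^T by rewrite -{1}PT -trmx_mul Pu.
split.
- by rewrite linearB /= PT trmx_mul trmxK.
- rewrite mulmxBl !mulmxBr PP !mulmxA Pu -[u *m u^T *m P]mulmxA uP.
  by rewrite -[u *m u^T *m u]mulmxA uu mulmx1 subrr subr0.
move=> j; rewrite ltnS leq_eqVlt => /predU1P[->|jk].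
  by rewrite mulmxBl Pu -mulmxA uu mulmx1 subrr.
by rewrite mulmxBl P0 // -uP -!mulmxA P0 // !mulmx0 subrr.
Qed.

Lemma gs_vec_orthonormal a k : (forall j, (j < k)%N -> gs_proj a j *m a j != 0) ->
  forall i j, (i < k)%N -> (j < k)%N ->
    (gs_vec a i)^T *m gs_vec a j = (i == j)%:R%:M.
Proof.
move=> a0; have lt_ij i j : (i < j)%N -> (j < k)%N -> (gs_vec a i)^T *m gs_vec a j = 0.
  move=> ij jk; have [|PT PP P0] := @gs_projP a j.
    by move=> l lj; apply: a0; exact: ltn_trans jk.
  rewrite {2}/gs_vec /normalize -scalemxAr mulmxA -PT.
  by rewrite -trmx_mul P0 // trmx0 mul0mx scaler0.
move=> i j ik jk; case: (ltngtP i j) => ij.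
- by rewrite lt_ij // raddf0.
- by rewrite -[LHS]trmxK trmx_mul trmxK lt_ij // trmx0 raddf0.
- by rewrite ij; apply: normalizeP; exact: a0.
Qed.

(* The vanishing rows of W say that 1 - gs_proj a k maps into the span of the
   first k columns of g. *)
Lemma gs_projE g a k : (k <= n)%N -> (forall j : 'I_n, a j = col j g) ->
  exists2 W : 'M[R]_n, 1%:M - gs_proj a k = g *m W &
    forall i j : 'I_n, (k <= i)%N -> W i j = 0.
Proof.
move=> + ag; elim: k => [_|k IH kn].
  by exists 0 => [|i j _]; rewrite ?mulmx0 ?subrr ?mxE.
have [W PW W0] := IH (ltnW kn).
pose j := Ordinal kn; pose c := (Num.sqrt (sqnorm (gs_proj a k *m a k)))^-1.
(* The coordinates of the normalised residual in the columns of g, since the projected vector is a k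
   - g W a k. *)
pose v := c *: (delta_mx j 0 - W *m a k) : 'cV[R]_n.
have uv : normalize (gs_proj a k *m a k) = g *m v.
  rewrite /v -scalemxAr mulmxBr -colE -(ag j) mulmxA -PW mulmxBl mul1mx.
  by rewrite opprB addrCA subrr addr0.
exists (W + v *m (g *m v)^T).
  by rewrite mulmxDr mulmxA -PW /= uv opprB addrCA addrC.
move=> i l ki; rewrite mxE W0 ?(ltnW ki) // add0r mxE big_ord1.
rewrite !mxE big1 => [|r _]; last by rewrite W0 ?mul0r // ltnW.
by rewrite subr0 (_ : (i == j) = false) ?mulr0 ?mul0r // -val_eqE gtn_eqF.
Qed.

(** A zero projection would give a k = g W a k, so by invertibility of g the k-th basis vector would
    equal W a k, whose k-th entry vanishes with row k of W. *)
Lemma gs_proj_neq0 g a k : g \in unitmx -> (k < n)%N ->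
  (forall j : 'I_n, a j = col j g) -> gs_proj a k *m a k != 0.
Proof.
move=> gU kn ag; apply/eqP => Pa0; pose j := Ordinal kn.
have [W PW W0] := gs_projE (ltnW kn) ag.
have : g *m (delta_mx j 0 - W *m a k) = 0.
  by rewrite mulmxBr -colE -(ag j) mulmxA -PW mulmxBl mul1mx Pa0 subr0 subrr.
move/(congr1 (mulmx (invmx g))); rewrite mulKmx // mulmx0 => /matrixP/(_ j 0).
rewrite !mxE big1 => [|r _]; last by rewrite W0 ?mul0r.
by rewrite !eqxx subr0 => /eqP; rewrite oner_eq0.
Qed.

End GramSchmidt.

(** The columns are indexed by [nat] to suit the recursion; [inord] returns a default index beyond
    n, where no column is ever read. *)
Definition gram_schmidt (R : realType) n (g : 'M[R]_n.+1) : 'M[R]_n.+1 :=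
  \matrix_(i, k) gs_vec (fun j => col (inord j) g) k i 0.

Section GramSchmidtMatrix.
Variables (R : realType) (n : nat).
Implicit Types g : 'M[R]_n.+1.

Lemma gram_schmidt_orthogonal g : g \in unitmx ->
  (gram_schmidt g)^T *m gram_schmidt g = 1%:M.
Proof.
move=> gU; apply/matrixP => i j; rewrite mxE.
have a0 k : (k < n.+1)%N ->
    gs_proj (fun j => col (inord j) g) k *m col (inord k) g != 0.
  by move=> kn; apply: (gs_proj_neq0 gU kn) => l; rewrite inord_val.
have /matrixP/(_ 0 0) := gs_vec_orthonormal a0 (ltn_ord i) (ltn_ord j).
rewrite !mxE mulr1n => <-; apply: eq_bigr => k _.
by rewrite !mxE.
Qed.

(** The projections remove nothing from orthonormal columns. Hence the rotation loop survives
    orthonormalisation unchanged and its transport stays explicit. *)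
Lemma gram_schmidt_id g : g^T *m g = 1%:M -> gram_schmidt g = g.
Proof.
move=> gg; have gij i j : (col i g)^T *m col j g = (i == j)%:R%:M.
  apply/matrixP => r s; rewrite !ord1 mxE; have /matrixP/(_ i j) := gg.
  rewrite !mxE => <-; apply: eq_bigr => k _.
  by rewrite !mxE.
have nid k : normalize (col k g) = col k g.
  by rewrite /normalize /sqnorm gij eqxx mxE sqrtr1 invr1 scale1r.
have Pid k j : (k <= j)%N -> (j < n.+1)%N ->
    gs_proj (fun j => col (inord j) g) k *m col (inord j) g = col (inord j) g.
  elim: k j => [|k IH] j kj jn; first by rewrite mul1mx.
  rewrite /= mulmxBl (IH j (ltnW kj) jn) (IH k (leqnn k) (ltn_trans kj jn)).
  rewrite nid -mulmxA gij.
  rewrite -val_eqE /= !inordK ?(ltn_trans kj jn) //.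
  by rewrite ltn_eqF // raddf0 mulmx0 subr0.
by apply/matrixP => i k; rewrite mxE /gs_vec Pid // nid inord_val mxE.
Qed.

Lemma entrywise_continuous_gram_schmidt (X : topologicalType)
    (G : X -> 'M[R]_n.+1) :
  entrywise_continuous G -> (forall x, G x \in unitmx) ->
  entrywise_continuous (fun x => gram_schmidt (G x)).
Proof.
move=> cG GU; pose a x j := col (inord j) (G x).
have ca j : entrywise_continuous (a ^~ j).
  by move=> i l; under eq_fun do rewrite mxE; exact: cG.
(* The only division is by the norm of the projected column, positive because G x is invertible.
   Vectors and projectors are then treated alternately. *)
have cn k : (k < n.+1)%N -> entrywise_continuous (fun x => gs_proj (a x) k) ->
    entrywise_continuous (fun x => gs_vec (a x) k).
  move=> kn cP; rewrite /gs_vec /normalize.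
  have cPa : entrywise_continuous (fun x => gs_proj (a x) k *m a x k).
    exact: entrywise_continuousM.
  apply: entrywise_continuousZ => // x; apply: cvgV.
    rewrite gt_eqF // sqrtr_gt0; apply: sqnorm_gt0.
    by apply: (gs_proj_neq0 (GU x) kn) => l; rewrite /a inord_val.
  apply: (@cvg_comp _ _ _ (fun x => sqnorm (gs_proj (a x) k *m a x k)) Num.sqrt);
    last exact: sqrt_continuous.
  by apply: (entrywise_continuousM (entrywise_continuous_tr cPa) cPa).
have cP k : (k <= n.+1)%N -> entrywise_continuous (fun x => gs_proj (a x) k).
  elim: k => [_|k IH kn]; first exact: entrywise_continuous_cst.
  have cu := cn k kn (IH (ltnW kn)).
  apply: entrywise_continuousB; first exact/IH/ltnW.
  by apply: entrywise_continuousM => //; exact: entrywise_continuous_tr.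
move=> i k; under eq_fun do rewrite mxE.
exact: (cn k (ltn_ord k) (cP _ (ltnW (ltn_ord k)))).
Qed.

End GramSchmidtMatrix.

(** * The homotopy invariant *)

Lemma entrywise_continuous_intertwiner (R : realType) (X : topologicalType) d
    (I : Type) (U V : X -> I -> 'M[R]_d) (s : seq I) :
  (forall i, entrywise_continuous (U ^~ i)) ->
  (forall i, entrywise_continuous (V ^~ i)) ->
  entrywise_continuous (fun x => intertwiner (U x) (V x) s).
Proof.
move=> cU cV; elim: s => [|i s IH] /=; first exact: entrywise_continuous_cst.
apply: entrywise_continuousZ; first by move=> x; exact: cvg_cst.
apply: entrywise_continuousD => //.
by apply: entrywise_continuousM => //; exact: entrywise_continuousM.
Qed.

Lemma entrywise_continuous_transport (R : realType) (X : topologicalType) d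
    (I : Type) (F : X -> nat -> I -> 'M[R]_d) (s : seq I) N :
  (forall k i, entrywise_continuous (fun x => F x k i)) ->
  entrywise_continuous (fun x => transport (F x) s N).
Proof.
move=> cF; elim: N => [|N IH] /=; first exact: entrywise_continuous_cst.
by apply: entrywise_continuousM => //; exact: entrywise_continuous_intertwiner.
Qed.

Lemma entrywise_continuous_frame_comb (R : realType) (X : topologicalType) d n
    (g : 'I_n -> 'M[R]_d) (q : X -> 'M[R]_n) (k : 'I_n) :
  entrywise_continuous q -> entrywise_continuous (fun x => frame_comb g (q x) k).
Proof.
move=> cq; apply: entrywise_continuous_sum => i.
by apply: entrywise_continuousZ; [exact: cq | exact: entrywise_continuous_cst].
Qed.

(** Provides a single step size valid at every stage of the homotopy, so that all loops share one
    subdivision. Compactness, in its near-covering form, makes the local bound uniform. *)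
Lemma uniformly_positive_near_diagonal (R : realType) (f : R * R * R -> R)
    (K : set (R * R)) :
  compact K -> continuous f -> (forall p, 0 < f (p, p.2)) ->
  exists2 e : R, 0 < e &
    forall p, K p -> forall h, `|h| < e -> 0 < f (p, p.2 + h).
Proof.
move=> cK cf f0.
have := cK; move/compact_near_coveringP.
move=> /(_ R (nbhs (0 : R)) (fun h p => 0 < f (p, p.2 + h)) _).
case.
  move=> p Kp.
  pose m (ph : R * R * R) := (ph.1, ph.1.2 + ph.2).
  have cm : continuous m.
    move=> x; have cfst : {for x, continuous (fst : R * R * R -> R * R)}.
      exact: cvg_fst.
    have csnd : {for x.1, continuous (snd : R * R -> R)} by exact: cvg_snd.
    have c12 := continuous_comp cfst csnd.
    apply: (@cvg_pair _ _ _ (nbhs x) (nbhs x.1) (nbhs (x.1.2 + x.2))) => //.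
    by apply: cvgD; [exact: c12 | exact: cvg_snd].
  have : f (m ph) @[ph --> (p, 0)] --> f (m (p, 0)).
    by apply: continuous_comp; [exact: cm | exact: cf].
  move=> /cvgr_gt /(_ 0); rewrite /m /= addr0 => /(_ (f0 p)).
  by [].
move=> e /= e0 He; exists e => // p Kp h he.
by apply: He => //=; rewrite sub0r normrN.
Qed.

Lemma frame_comb_gram_schmidt_rot (R : realType) d n
    (g : 'I_(2 + n) -> 'M[R]_d) t :
  frame_comb g (gram_schmidt (rot n t)) = frame_comb g (rot n t).
Proof. by rewrite gram_schmidt_id //; exact: rot_orthogonal. Qed.

Lemma rotation_loop_not_contractible (R : realType) n (T : R)
    (H : R * R -> 'M[R]_(2 + n)) :
  0 <= T -> entrywise_continuous H -> (forall p, H p \in unitmx) ->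
  (forall t, H (0, t) = 1%:M) -> (forall t, H (T, t) = rot n t) ->
  (forall s, H (s, pi *+ 2) = H (s, 0)) -> False.
Proof.
move=> T0 cH HU H0 HT Hloop.
have [d [D [g [Dg cg]]]] := exists_clifford_frame R (2 + n).
pose U p k := frame_comb g (gram_schmidt (H p)) k.
have DU p : clifford_frame D (U p).
  by apply: clifford_frame_comb => //; exact: gram_schmidt_orthogonal.
have cU k : entrywise_continuous (U ^~ k).
  by apply: entrywise_continuous_frame_comb; exact: entrywise_continuous_gram_schmidt.
pose e := enum 'I_(2 + n).
(* With x = ((s, t), t'), this compares the frames at times t and t' of loop s; for t' = t the
   intertwiner is 1. *)
pose f (x : R * R * R) := \det (intertwiner (U x.1) (U (x.1.1, x.2)) e).
have cf : continuous f.
  apply: continuous_det; apply: entrywise_continuous_intertwiner => k.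
    by apply: (@entrywise_continuous_comp _ _ _ _ _ (U ^~ k) fst) => // x; exact: cvg_fst.
  apply: (@entrywise_continuous_comp _ _ _ _ _ (U ^~ k)
    (fun x : R * R * R => (x.1.1, x.2))) => // x.
  have cfst : {for x, continuous (fst : R * R * R -> R * R)} by exact: cvg_fst.
  have cfst' : {for x.1, continuous (fst : R * R -> R)} by exact: cvg_fst.
  have c11 := continuous_comp cfst cfst'.
  by apply: (@cvg_pair _ _ _ (nbhs x) (nbhs x.1.1) (nbhs x.2)) => //; exact: cvg_snd.
have f0 p : 0 < f (p, p.2).
  rewrite /f /= -surjective_pairing intertwiner_id ?det1 // => i _.
  by have [] := DU p.
have [r r0 fr] := uniformly_positive_near_diagonal
  (compact_setX (@segment_compact R 0 T) (@segment_compact R 0 (pi *+ 2))) cf f0.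
have pi0 := pi_gt0 R.
(* One successor already gives h < r; N >= 3 also gives h < pi, which makes cos (h / 2) positive at
   the end. *)
pose N := (Num.trunc (pi *+ 2 / r)).+3.
have N0 : 0 < N%:R :> R by rewrite ltr0n.
pose h : R := pi *+ 2 / N%:R.
have h0 : 0 < h by rewrite divr_gt0 // pmulrn_lgt0.
have hr : h < r.
  rewrite ltr_pdivrMr // mulrC -ltr_pdivrMr //.
  by apply: lt_trans (truncnS_gt _) _; rewrite ltr_nat.
have hN : h * N%:R = pi *+ 2 by rewrite divfK // gt_eqF.
pose F s k := U (s, h * k%:R).
pose P s := transport (F s) e N.
have detP s : s \in `[0, T] -> \det (P s) != 0.
  move=> sT; apply: det_transport_neq0 => k kN; rewrite gt_eqF //.
  have Kp : (`[0, T] `*` `[0, pi *+ 2]) (s, h * k%:R).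
    split => //=; rewrite in_itv /= mulr_ge0 ?(ltW h0) //=.
    by rewrite -hN ler_pM2l // ler_nat ltnW.
  have nh : `|h| < r by rewrite gtr0_norm.
  have := fr _ Kp h nh; rewrite /f /=.
  by have -> : h * k%:R + h = h * k.+1%:R by rewrite -natr1 mulrDr mulr1.
(* Because the loop closes, the transport intertwines the initial system with itself. It also
   commutes with [D], so irreducibility applies. *)
have Pscalar s : exists c, P s = c%:M.
  apply: cg => [|X DX]; last first.
    by apply: (transport_comm _ _ (D := D)) => [k|]; [exact: DU | exact: DX].
  apply: (frame_comb_comm (gram_schmidt_orthogonal (HU (s, 0)))) => k.
  have FE : F s 0%N k = F s N k by rewrite /F hN mulr0 /U Hloop.
  rewrite -[frame_comb _ _ _]/(U (s, 0) k).
  have -> : U (s, 0) k = F s 0%N k by rewrite /F mulr0.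
  by rewrite {2}FE; apply: transportP => [j|]; [exact: DU | rewrite mem_enum].
pose l s := P s 0 0.
have l_neq0 s : s \in `[0, T] -> l s != 0.
  move=> /detP; rewrite /l; have [c ->] := Pscalar s.
  by rewrite det_scalar mxE eqxx expf_eq0 /= mulr1n.
have cl : continuous l.
  apply: (entrywise_continuous_transport (F := F)) => k i.
  apply: (@entrywise_continuous_comp _ _ _ _ _ (U ^~ i)
    (fun s : R => (s, h * k%:R))) => // x.
  by apply: (@cvg_pair _ _ _ (nbhs x) (nbhs x) (nbhs (h * k%:R))) => //; exact: cvg_cst.
have l0 : l 0 = 1.
  rewrite /l /P (@transport_const _ _ D) ?mxE ?eqxx // => k.
    exact: DU.
  by move=> i; rewrite /F /U !H0.
have lT : l T = - cos (h / 2) ^+ N.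
  rewrite /l /P.
  have -> : F T = (fun k => frame_comb g (rot n (h * k%:R))).
    apply/funext => k; rewrite -frame_comb_gram_schmidt_rot.
    by apply/funext => i; rewrite /F /U HT.
  rewrite (transport_rot _ _ Dg).
  (* The half-angles add up to pi, where the rotor is -1: this is the sign that obstructs the
     contraction. *)
  have -> : h / 2 * N%:R = pi by rewrite mulrAC hN; field.
  by rewrite /rotor cospi sinpi scale0r addr0 !mxE eqxx mulr1 mulrN1.
have lT0 : l T < 0.
  have h_pi : h < pi.
    by rewrite ltr_pdivrMr // -[pi *+ 2]mulr_natr ltr_pM2l // ltr_nat.
  by rewrite lT oppr_lt0 exprn_gt0 // cos_gt0_pihalf //; lra.
have [|s sT] := @IVT R l 0 T 0 T0 (continuous_subspaceT cl).
  by rewrite l0 ge_min (ltW lT0) orbT le_max ler01.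
by move=> ls; have := l_neq0 s sT; rewrite ls eqxx.
Qed.

(** * From a feedback law to a contraction of the rotation loop *)

Theorem mainTheorem3 (R : realType) (n m : nat) (hn : (2 <= n)%N)
    (hm : (1 <= m)%N) (A : 'M[R]_n) (B : 'M[R]_(n, m)) (hB : \rank B = m)
    (hAB : kalman_condition A B) (tfn : R) (htfn : 0 < tfn) :
  ~ exists (K : 'M[R]_n -> R -> 'M[R]_(m, n)) (Phi : 'M[R]_n -> R -> 'M[R]_n),
      [/\ forall F : 'M[R]_n, GLpos R n F ->
            [/\ mx_integrable `[0, tfn] (K F),
                is_solution A B tfn (K F) (Phi F)
              & Phi F tfn = F],
          set_fun (`[0, tfn] `*` GLpos R n) (GLpos R n)
            (fun p : R * 'M[R]_n => Phi p.2 p.1)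
        & {within `[0, tfn] `*` GLpos R n,
            continuous (fun p : R * 'M[R]_n => Phi p.2 p.1)}].
Proof.
case: n => [|[|n]] // in hn A B hB hAB *.
move=> [K [Phi [Phi_sol Phi_pos Phi_cont]]].
(* Retracting the line onto [0, tfn] makes the homotopy continuous on the whole plane, so the
   continuity within a subset can be composed away. *)
pose clamp (s : R) := Num.max 0 (Num.min s tfn).
have clamp_cont : continuous clamp.
  move=> s.
  apply: (@continuous_max R R (fun=> 0) (fun s => Num.min s tfn)).
    exact: cvg_cst.
  by apply: (@continuous_min R R id (fun=> tfn)); [exact: cvg_id | exact: cvg_cst].
have clampP s : clamp s \in `[0, tfn].
  rewrite in_itv /= /clamp le_max lexx /=.
  by rewrite ge_max (ltW htfn) ge_min lexx orbT.
have rot_pos t : GLpos R n.+2 (rot n t) by rewrite /GLpos /= det_rot.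
pose c (p : R * R) := (clamp p.1, rot n p.2 : 'M[R]_n.+2).
have cA p : (`[0, tfn] `*` GLpos R n.+2) (c p).
  by split; [exact: clampP | exact: rot_pos].
have c_cont : continuous c.
  move=> p; apply: (@cvg_pair _ _ _ (nbhs p) (nbhs (clamp p.1))
    (nbhs (rot n p.2 : 'M[R]_n.+2))).
  - have cfst : {for p, continuous (fst : R * R -> R)} by exact: cvg_fst.
    exact: (continuous_comp cfst (clamp_cont _)).
  have csnd : {for p, continuous (snd : R * R -> R)} by exact: cvg_snd.
  apply: (continuous_comp csnd).
  exact: (entrywise_continuous_continuous (@entrywise_continuous_rot R n)).
(* The homotopy follows the trajectories steered to the rotations: the initial condition makes it 1
   at time 0, the target condition makes it the rotation at time tfn. *)
pose H p := Phi (c p).2 (c p).1.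
have H_cont : continuous H.
  exact: (continuous_comp_within Phi_cont c_cont cA).
apply: (@rotation_loop_not_contractible R n tfn (H : R * R -> 'M[R]_(2 + n))).
- exact: ltW.
- move=> i j p.
  apply: (@continuous_comp _ _ _ H (fun M : 'M[R]_n.+2 => M i j)).
    exact: H_cont.
  exact: coord_continuous.
- move=> p; rewrite unitmxE unitfE; apply: lt0r_neq0.
  exact: (Phi_pos _ (cA p)).
- move=> t; rewrite /H /c /clamp /= minElt htfn maxxx.
  by have [_ [_ _ ->]] := Phi_sol _ (rot_pos t).
- move=> t; rewrite /H /c /clamp /= minxx maxElt htfn.
  by have [] := Phi_sol _ (rot_pos t).
- move=> s; rewrite /H /c /=; congr (Phi _ _).
  by rewrite /rot /rot2 cos2pi cos0 sin0 -[pi *+ 2]add0r sinD2pi sin0.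
Qed.
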